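(* Let $\mathcal{S}$ be a finite state space, $V:\mathcal{S}\to\mathbb{R}$ a function, and let $\pi$ be the probability distribution on $\mathcal{S}$ with $\pi(s)\propto\exp(-V(s))$. Let $T(g\mid f)$ be a transition kernel on $\mathcal{S}$ satisfying the detailed balance condition $\pi(f)\,T(g\mid f)=\pi(g)\,T(f\mid g)$ for all $f,g\in\mathcal{S}$. Let $P_t$ ($t=0,1,2,\dots$) be probability distributions on $\mathcal{S}$ evolving according to $P_{t+1}(g)=\sum_{f\in\mathcal{S}}P_t(f)\,T(g\mid f)$. Then for every $t\ge 0$, $$\mathrm{KL}(P_{t+1}\,\|\,\pi)\le \mathrm{KL}(P_t\,\|\,\pi).$$
   Context: A transition kernel $T$ satisfies $T(g\mid f)\ge 0$ and $\sum_{g\in\mathcal{S}}T(g\mid f)=1$ for every $f\in\mathcal{S}$; $T(g\mid f)$ is the probability of moving from $f$ to $g$. $\mathrm{KL}(P\|\pi)=\sum_{s}P(s)\log\frac{P(s)}{\pi(s)}$, with the convention $0\log 0=0$. *)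

(* Defs.v *)
From mathcomp Require Import all_boot all_order all_algebra.
From mathcomp Require Import reals exp.

Set Implicit Arguments.
Unset Strict Implicit.
Unset Printing Implicit Defensive.

Import Order.TTheory GRing.Theory Num.Theory.
Local Open Scope ring_scope.

Definition is_distribution (R : realType) (S : finType) (P : S -> R) : Prop :=
  (forall s, 0 <= P s) /\ \sum_(s : S) P s = 1.

Definition proportional (R : realType) (S : finType) (p w : S -> R) : Prop :=
  exists c : R, forall s, p s = c * w s.

(* [T g f] is the probability T(g | f) of moving from f to g: the target comes
   first. *)
Definition transition_kernel (R : realType) (S : finType) (T : S -> S -> R)
  : Prop :=
  forall f, is_distribution (fun g => T g f).

Definition detailed_balance (R : realType) (S : finType) (pi : S -> R)
    (T : S -> S -> R) : Prop :=
  forall f g, pi f * T g f = pi g * T f g.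

(* A summand with [P s = 0] vanishes, which is the convention 0 log 0 = 0.
   This is the usual divergence when [pi s = 0] implies [P s = 0], in particular
   when [pi] is positive everywhere; it is real-valued, so the value +oo of the
   remaining case is not represented. *)
Definition KL (R : realType) (S : finType) (P pi : S -> R) : R :=
  \sum_(s : S) P s * ln (P s / pi s).

(* Main.v *)
Require Import Defs.
From mathcomp Require Import all_boot all_order all_algebra.
From mathcomp Require Import reals sequences exp.
From mathcomp Require Import ring lra.

Import Order.TTheory GRing.Theory Num.Theory.
Local Open Scope ring_scope.

(** Detailed balance makes [pi] stationary. With the densities [a f = P f / pi f]
    and [b g = Q g / pi g], where [Q] is the law after one step, the entropy drop is
    the sum over [f, g] of [pi f * T g f * (a f * (ln (a f) - ln (b g)))]. The
    inequality [a * (ln a - ln b) >= a - b] bounds it below by the sum of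
    [pi f * T g f * (a f - b g)], which is [1 - 1 = 0] by stationarity. *)

(** For [a > 0] this is [ln x <= x - 1] at [x = b / a], multiplied by [a]. For [a = 0] the factor
    [a] cancels whatever value [ln 0] has. *)
Lemma subr_le_mul_ln (R : realType) (a b : R) :
  0 <= a -> 0 < b -> a - b <= a * (ln a - ln b).
Proof.
rewrite le_eqVlt => /predU1P[<- b0|a0 b0].
  by rewrite mul0r sub0r oppr_le0 ltW.
have ba0 : 0 < b / a by rewrite divr_gt0.
have : ln (b / a) <= b / a - 1.
  have := @le_ln1Dx R (b / a - 1); rewrite addrCA subrr addr0; apply; lra.
rewrite ln_div ?posrE// => /(ler_wpM2l (ltW a0)).
rewrite !mulrBr mulr1 mulrCA divff ?gt_eqF// mulr1; lra.
Qed.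

(** The sign of the constant [c] is not given. Since the exponential never vanishes, a zero of [p]
    would force [c = 0], and the total mass would be 0 instead of 1. *)
Lemma proportional_expR_gt0 (R : realType) (S : finType) (V p : S -> R) :
  is_distribution p -> proportional p (fun s => expR (- V s)) ->
  forall s, 0 < p s.
Proof.
move=> [p0 p1] [c pE] s; rewrite lt_def p0 andbT.
apply/eqP => ps0; move/eqP: p1; apply/negP.
have /eqP c0 : c == 0.
  by move/eqP: ps0; rewrite pE mulf_eq0 (gt_eqF (expR_gt0 _)) orbF.
rewrite big1 => [|i _]; last by rewrite pE c0 mul0r.
by rewrite eq_sym oner_eq0.
Qed.

Lemma detailed_balance_stationary (R : realType) (S : finType) (pi : S -> R)
    (T : S -> S -> R) :
  transition_kernel T -> detailed_balance pi T ->
  forall g, \sum_f pi f * T g f = pi g.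
Proof.
move=> Tk Tb g; under eq_bigr do rewrite Tb.
by rewrite -mulr_sumr (Tk g).2 mulr1.
Qed.

Lemma KL_stationary_step (R : realType) (S : finType) (pi : S -> R)
    (T : S -> S -> R) (P Q : S -> R) :
  (forall s, 0 < pi s) -> transition_kernel T ->
  (forall g, \sum_f pi f * T g f = pi g) ->
  (forall s, 0 <= P s) -> (forall g, Q g = \sum_f P f * T g f) ->
  KL Q pi <= KL P pi.
Proof.
move=> pi0 Tk piT P0 QE.
have PT0 g f : 0 <= P f * T g f by rewrite mulr_ge0// (Tk f).1.
have piN0 s : pi s != 0 by rewrite gt_eqF.
(* Inserting [1 = \sum_g T g f] spreads a sum over states across transitions, so both divergences
   become sums over the same pairs. *)
have sumT F : \sum_f P f * F f = \sum_g \sum_f P f * T g f * F f.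
  rewrite exchange_big; apply: eq_bigr => f _ /=.
  by rewrite -mulr_suml -mulr_sumr (Tk f).2 mulr1.
have dropE : KL P pi - KL Q pi =
    \sum_g \sum_f P f * T g f * (ln (P f / pi f) - ln (Q g / pi g)).
  rewrite /KL sumT -sumrB; apply: eq_bigr => g _.
  by rewrite {1}QE mulr_suml -sumrB; apply: eq_bigr => f _; rewrite mulrBr.
(* The lower bounds cancel for each target [g] separately: the first terms sum to [Q g], the second,
   by stationarity, to [pi g * (Q g / pi g)]. *)
have bound0 : \sum_g \sum_f (P f * T g f - pi f * T g f * (Q g / pi g)) = 0.
  rewrite big1// => g _.
  by rewrite sumrB -QE -mulr_suml piT mulrCA divff// mulr1 subrr.
rewrite -subr_ge0 dropE -[leLHS]bound0.
apply: ler_sum => g _; apply: ler_sum => f _.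
have Q0 : 0 <= Q g by rewrite QE sumr_ge0.
(* The logarithmic inequality needs [Q g > 0]. If [Q g = 0], every nonnegative summand [P f * T g f]
   of [Q g] vanishes, and both sides are 0. *)
move: Q0; rewrite le_eqVlt => /predU1P[Qg0|Qg0].
  have /eqP PT : P f * T g f == 0.
    have /eqP := esym (QE g); rewrite -Qg0 psumr_eq0// => /allP/(_ f).
    by rewrite mem_index_enum => /(_ isT).
  by rewrite PT -Qg0 !mul0r mulr0 subrr.
have a0 : 0 <= P f / pi f by rewrite divr_ge0// ltW.
have w0 : 0 <= pi f * T g f by rewrite mulr_ge0 ?(Tk f).1// ltW.
have -> : P f * T g f = pi f * T g f * (P f / pi f) by field.
rewrite -mulrBr -[leRHS]mulrA; apply: ler_wpM2l => //.
exact: subr_le_mul_ln a0 (divr_gt0 Qg0 (pi0 g)).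
Qed.

Theorem theorem4p5 (R : realType) (S : finType) (V : S -> R) (pi : S -> R)
    (T : S -> S -> R) (P : nat -> S -> R)
    (pi_distr : is_distribution pi)
    (pi_prop : proportional pi (fun s => expR (- V s)))
    (T_kernel : transition_kernel T)
    (T_balance : detailed_balance pi T)
    (P_distr : forall t : nat, is_distribution (P t))
    (P_step : forall (t : nat) (g : S),
        P t.+1 g = \sum_(f : S) P t f * T g f) :
  forall t : nat, KL (P t.+1) pi <= KL (P t) pi.
Proof.
move=> t; apply: (KL_stationary_step _ _ _ T) => //.
- exact: proportional_expR_gt0 pi_distr pi_prop.
- exact: detailed_balance_stationary.
- exact: (P_distr t).1.
Qed.
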